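(* Let $\beta$ be a constant with $0<\beta<1$. For $n$ such that $\beta\log_2 n$ is a positive integer dividing $n$, let $f$ be a read-once DNF formula on $n$ variables in which every term has exactly $\beta\log_2 n$ (unnegated) variables and every variable appears in exactly one term. Then, as $n\to\infty$, $E_f[OPT] = \Omega(n^\beta)$ and $E_f[CERT] = O(\log n)$.
   Context: For a Boolean function $f$ on $n$ variables, consider unit costs and the uniform distribution on $x\in\{0,1\}^n$ (each $x_i$ independently $1$ with probability $1/2$). $E_f[OPT]$ is the minimum, over all adaptive testing strategies (decision trees) computing $f$, of the expected number of variables tested on random $x$. A partial assignment $b\in\{0,1,*\}^n$ is a certificate of $f$ if $f$ is constant on all $a$ agreeing with $b$ on its non-$*$ positions; its size is the number of non-$*$ positions; $x$ contains $b$ if $x_i=b_i$ whenever $b_i\neq *$. $E_f[CERT]$ is the expected value, over uniform random $x$, of the minimum size of a certificate of $f$ contained in $x$. A read-once DNF is a DNF in which each variable appears at most once. *)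

(* Defs.v *)
From mathcomp Require Import all_boot all_order all_algebra.
From mathcomp Require Import boolp classical_sets reals topology normedtype.
From mathcomp Require Import sequences exp.
Set Implicit Arguments.
Unset Strict Implicit.
Unset Printing Implicit Defensive.
Import Order.TTheory GRing.Theory Num.Theory.
Local Open Scope ring_scope.

Notation input n := {ffun 'I_n -> bool}.

Section Expectation.
Variables (R : realType) (n : nat).

Definition expect (g : input n -> nat) : R :=
  (\sum_(x : input n) (g x)%:R) / 2 ^+ n.

End Expectation.

Section DecisionTrees.
Variable n : nat.

Inductive dtree : Type :=
| Leaf of bool
| Node of 'I_n & dtree & dtree.

(* [Node i t0 t1] tests variable i and continues with t0 if it is 0 and with
   t1 if it is 1. *)
Fixpoint dt_eval (t : dtree) (x : input n) : bool :=
  match t with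
  | Leaf b => b
  | Node i t0 t1 => dt_eval (if x i then t1 else t0) x
  end.

(* As a set of variables, so that testing again a variable whose value is
   already known is free. *)
Fixpoint dt_tested (t : dtree) (x : input n) : {set 'I_n} :=
  match t with
  | Leaf _ => finset.set0
  | Node i t0 t1 => i |: dt_tested (if x i then t1 else t0) x
  end.

Definition dt_cost (t : dtree) (x : input n) : nat := #|dt_tested t x|.

Definition dt_computes (t : dtree) (f : input n -> bool) : Prop :=
  forall x, dt_eval t x = f x.

End DecisionTrees.

Section Certificates.
Variable n : nat.

(* [None] stands for the symbol * *)
Definition passign := {ffun 'I_n -> option bool}.

Definition contains (x : input n) (b : passign) : bool :=
  [forall i, (b i != None) ==> (b i == Some (x i))].

Definition is_cert (f : input n -> bool) (b : passign) : bool :=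
  [forall a : input n, forall a' : input n,
     contains a b ==> contains a' b ==> (f a == f a')].

Definition pa_size (b : passign) : nat := #|[set i | b i != None]|.

Definition total_pa (x : input n) : passign := [ffun i => Some (x i)].

Lemma total_pa_cert (f : input n -> bool) (x : input n) :
  is_cert f (total_pa x) && contains x (total_pa x).
Proof.
have eqx a : contains a (total_pa x) -> a = x.
  move=> /forallP h; apply/ffunP => i.
  by have := h i; rewrite ffunE /= => /eqP[].
apply/andP; split; last by apply/forallP => i; rewrite ffunE eqxx implybT.
apply/forallP => a; apply/forallP => a'.
by apply/implyP => /eqx ->; apply/implyP => /eqx ->.
Qed.

(* The minimum ranges over a nonempty set, by [total_pa_cert]. *)
Definition cert_size (f : input n -> bool) (x : input n) : nat :=
  pa_size [arg min_(b < total_pa x | is_cert f b && contains x b)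
             pa_size b]%N.

End Certificates.

Section OptCert.
Variables (R : realType) (n : nat) (f : input n -> bool).

(* The infimum is attained, see [E_OPT_min]. *)
Definition E_OPT : R :=
  inf [set expect R (dt_cost t) | t in [set t : dtree n | dt_computes t f]].

Definition E_CERT : R := expect R (cert_size f).

End OptCert.

Section OptAttained.
Variables (n : nat) (f : input n -> bool).

Fixpoint full_tree (s : seq 'I_n) (y : input n) : dtree n :=
  if s is i :: s' then
    Node i (full_tree s' [ffun j => if j == i then false else y j])
           (full_tree s' [ffun j => if j == i then true else y j])
  else Leaf n (f y).

Lemma full_tree_eval s y x :
  dt_eval (full_tree s y) x = f [ffun j => if j \in s then x j else y j].
Proof.
elim: s y => [|i s IH] y /=.
  by congr f; apply/ffunP => j; rewrite ffunE.
by case xi: (x i); rewrite IH; congr f; apply/ffunP => j;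
  rewrite !ffunE in_cons; case: eqP => [->|] //=; rewrite xi; case: ifP.
Qed.

Lemma computing_tree : exists t, dt_computes t f.
Proof.
exists (full_tree (enum 'I_n) [ffun=> false]) => x.
rewrite full_tree_eval; congr f; apply/ffunP => j.
by rewrite ffunE mem_enum.
Qed.

Lemma E_OPT_min (R : realType) :
  exists2 t, dt_computes t f & E_OPT R f = expect R (dt_cost t).
Proof.
pose tot t := (\sum_(x : input n) dt_cost t x)%N.
have expectE t : expect R (dt_cost t) = (tot t)%:R / 2 ^+ n.
  by rewrite /expect /tot natr_sum.
pose P m := `[< exists2 t, dt_computes t f & tot t = m >].
have exP : exists m, P m.
  by have [t tf] := computing_tree; exists (tot t); apply/asboolP; exists t.
case: (ex_minnP exP) => m /asboolP[t tf tm] mmin; exists t => //.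
have lbt : lbound [set expect R (dt_cost t) |
    t in [set t : dtree n | dt_computes t f]] (expect R (dt_cost t)).
  move=> _ [u uf <-]; rewrite !expectE ler_pM2r ?invr_gt0 ?exprn_gt0//.
  by rewrite ler_nat tm; apply: mmin; apply/asboolP; exists u.
apply/eqP; rewrite eq_le; apply/andP; split.
  by apply: ge_inf; [exists (expect R (dt_cost t)) | exists t].
by apply: lb_le_inf => //; exists (expect R (dt_cost t)); exists t.
Qed.

End OptAttained.

Section DNF.
Variable n : nat.

(* (i, true) is the literal x_i, and (i, false) its negation *)
Definition literal := ('I_n * bool)%type.
Definition term := seq literal.
Definition dnf := seq term.

Definition dnf_eval (phi : dnf) (x : input n) : bool :=
  has (fun t : term => all (fun l : literal => x l.1 == l.2) t) phi.

Definition term_vars (t : term) : seq 'I_n := [seq l.1 | l <- t].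

Definition read_once (phi : dnf) : Prop :=
  uniq (flatten [seq term_vars t | t <- phi]).

Definition monotone_dnf (phi : dnf) : Prop :=
  forall t, t \in phi -> forall l, l \in t -> l.2 = true.

Definition terms_of_size (k : nat) (phi : dnf) : Prop :=
  forall t, t \in phi -> size (term_vars t) = k.

Definition each_var_in_one_term (phi : dnf) : Prop :=
  forall i : 'I_n, count (fun t => i \in term_vars t) phi = 1%N.

End DNF.

Definition log2 (R : realType) (x : R) : R := ln x / ln 2.

(* [k] is the value of beta * log_2 n,
   required to be a positive integer dividing [n]. *)
Definition admissible (R : realType) (beta : R) (n : nat) (phi : dnf n) :
    Prop :=
  exists k : nat,
    [/\ k%:R = beta * log2 (n%:R : R), (0 < k)%N & (k %| n)%N] /\
    [/\ read_once phi, monotone_dnf phi, terms_of_size k phi &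
        each_var_in_one_term phi].

(* Main.v *)
Require Import Defs.
From mathcomp Require Import all_boot all_order all_algebra.
From mathcomp Require Import boolp classical_sets reals topology normedtype.
From mathcomp Require Import sequences exp.
From mathcomp Require Import zify ring lra.
Import Order.TTheory GRing.Theory Num.Theory.
Local Open Scope ring_scope.
Local Open Scope classical_set_scope.

(** With [k = beta * log2 n] the formula has [m = n / k] terms, and [2 ^ k] is
    [n ^ beta]. It is false with probability [(1 - 2^-k)^m <= exp (- m / 2^k)],
    which is at most [1 / n] for large [n]. A true input has a certificate of
    size [k], so the expected certificate size is at most [k + n * (1 / n)].

    For the lower bound, give a term that has [j] tested variables, all equal
    to 1, the potential [2^j - 1], and give potential 0 to a term in which a 0
    was found. A test of a new variable increases the expected total potential
    by at most [1 / 2]. On a true input a correct tree has verified a whole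
    term, so it ends with potential at least [2^k - 1 >= 2^k / 2]. Hence the
    expected cost is at least [2^k] times the probability of truth. *)

(** * Counting inputs by flipping one variable *)

Section Flip.
Context {n : nat}.
Implicit Types (x : input n) (i : 'I_n) (C : pred (input n)).

Definition flip i x : input n := [ffun j => x j (+) (j == i)].

Lemma flipE i x j : flip i x j = x j (+) (j == i).
Proof. by rewrite ffunE. Qed.

Lemma flipK i : involutive (flip i).
Proof. by move=> x; apply/ffunP => j; rewrite !flipE addbK. Qed.

Lemma sum_flip i C (F : input n -> nat) : (forall x, C (flip i x) = C x) ->
  (\sum_(x | C x) F (flip i x) = \sum_(x | C x) F x)%N.
Proof.
move=> iC; rewrite [RHS](reindex_inj (inv_inj (flipK i))).
by apply: eq_bigl => x; rewrite iC.
Qed.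

Lemma card_half i C : (forall x, C (flip i x) = C x) ->
  ((\sum_(x | C x && x i) 1).*2 = \sum_(x | C x) 1)%N.
Proof.
move=> iC; rewrite -addnn.
have -> : (\sum_(x | C x && x i) 1 = \sum_(x | C x) x i)%N.
  by rewrite big_mkcondr; apply: eq_bigr => x _; case: (x i).
rewrite -{2}(sum_flip i) // -big_split; apply: eq_bigr => x _ /=.
by rewrite flipE eqxx addbT; case: (x i).
Qed.

(** Requiring one more variable of [s] to be 1 halves the count, because [C] and the conditions on
    the other variables survive its flip. *)
Lemma card_all_true (s : seq 'I_n) C : uniq s ->
  (forall i x, i \in s -> C (flip i x) = C x) ->
  (2 ^ size s * \sum_(x | C x && all x s) 1 = \sum_(x | C x) 1)%N.
Proof.
elim: s => [|i s IH] /=.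
  by move=> _ _; rewrite mul1n; apply: eq_bigl => x; rewrite andbT.
move=> /andP[nis us] sC; rewrite -IH //; last first.
  by move=> j x js; apply: sC; rewrite in_cons js orbT.
rewrite expnSr -mulnA mul2n; congr (_ * _)%N.
rewrite -(card_half i); last first.
  move=> x; rewrite sC ?mem_head //; congr (_ && _).
  apply: eq_in_all => j js; rewrite flipE.
  by case: eqP nis => [<-|]; rewrite ?js // addbF.
by congr (_.*2); apply: eq_bigl => x; rewrite -andbA [x i && _]andbC.
Qed.

(** This is the probability [(1 - 2^-k)^m] that no term holds, multiplied out to stay in [nat].
    Terms share no variables, so the other terms being false is unaffected by flips inside [s]: the
    events are independent. *)
Lemma card_none_true k (ss : seq (seq 'I_n)) :
  uniq (flatten ss) -> {in ss, forall s, size s = k} ->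
  (2 ^ (k * size ss) * \sum_(x : input n | ~~ has (all x) ss) 1 =
   (2 ^ k - 1) ^ size ss * 2 ^ n)%N.
Proof.
elim: ss => [_ _|s ss IH] /=.
  by rewrite muln0 !mul1n sum1_card cardT -cardE card_ffun card_bool card_ord.
rewrite cat_uniq => /and3P[us /hasPn dis uss] sz.
have sk : size s = k by apply: sz; rewrite mem_head.
have {}IH := IH uss (fun t ts => sz t (mem_behead (s := s :: ss) ts)).
pose C (x : input n) := ~~ has (all x) ss.
have iC i x : i \in s -> C (flip i x) = C x.
  move=> si; congr (~~ _); apply: eq_in_has => t tss.
  apply: eq_in_all => j jt; rewrite flipE; case: eqP => [ji|_]; last first.
    by rewrite addbF.
  have /dis : j \in flatten ss by apply/flattenP; exists t.
  by rewrite /= ji si.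
have := card_all_true s C us iC; rewrite sk.
rewrite [X in _ = X -> _](bigID (fun x : input n => all x s)) /=.
have -> : (\sum_(x : input n | ~~ (all x s || has (all x) ss)) 1 =
           \sum_(x | C x && ~~ all x s) 1)%N.
  by apply: eq_bigl => x; rewrite negb_or andbC.
move: IH; rewrite -/C (bigID (fun x : input n => all x s)) /=.
rewrite mulnS expnD expnS.
(* With all of [ss] false, [a] counts the inputs making [s] true and [b] those making it false;
   independence gives [2 ^ k * a = a + b]. *)
set a := (\sum_(x | _ && all _ _) _)%N; set b := (\sum_(x | _) _)%N.
move=> IH ab; have -> : b = ((2 ^ k - 1) * a)%N by rewrite mulnBl mul1n ab addKn.
by rewrite -[RHS]mulnA -IH -ab mulnACA [in RHS]mulnA [RHS]mulnACA
  [X in (X * _)%N]mulnC.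
Qed.

End Flip.

(** * Growth of a potential along a decision tree *)

Section Potential.
Context {n : nat}.
Implicit Types (x : input n) (i : 'I_n) (S : {set 'I_n}).

(* An optional stopping inequality. [C] plays the role of the set of inputs
   that reach the node, and [S] of the set of variables tested above it. *)
Lemma potential_cost (Phi : {set 'I_n} -> input n -> nat) :
  (forall i S x, i \notin S ->
     Phi (i |: S) x + Phi (i |: S) (flip i x) <= (Phi S x).*2 + 1)%N ->
  forall (t : dtree n) S (C : pred (input n)),
  (forall i x, i \notin S -> C (flip i x) = C x) ->
  ((\sum_(x | C x) Phi (S :|: dt_tested t x) x).*2 <=
   (\sum_(x | C x) Phi S x).*2 + \sum_(x | C x) #|dt_tested t x :\: S|)%N.
Proof.
move=> step; elim=> [b|i t0 IH0 t1 IH1] S C iC /=.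
  by under eq_bigr do rewrite finset.setU0; rewrite leq_addr.
(* The cost of the root alone: a new variable is handled by pairing [x] with [flip i x], and a
   repeated one changes nothing. *)
have stepC : ((\sum_(x | C x) Phi (i |: S) x).*2 <=
    (\sum_(x | C x) Phi S x).*2 + \sum_(x | C x) (i \notin S))%N.
  have [iS|iS] /= := boolP (i \in S).
    have /finset.setUidPr -> : [set i]%SET \subset S by rewrite finset.sub1set.
    exact: leq_addr.
  rewrite -addnn -{2}(sum_flip i) => [|x]; last exact: iC.
  rewrite -big_split -muln2 big_distrl -big_split /=.
  by apply: leq_sum => x _; rewrite muln2 step.
(* The inputs entering either branch are again closed under flips of untested variables, so the
   induction hypotheses apply to them. *)
have iCb (b : bool) j x : j \notin i |: S ->
    C (flip j x) && (flip j x i == b) = C x && (x i == b).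
  rewrite finset.in_setU1 negb_or => /andP[ji jS].
  by rewrite iC // flipE [i == j]eq_sym (negbTE ji) addbF.
pose tested x := dt_tested (if x i then t1 else t0) x.
have IH : ((\sum_(x | C x) Phi ((i |: S) :|: tested x) x).*2 <=
    (\sum_(x | C x) Phi (i |: S) x).*2 +
    \sum_(x | C x) #|tested x :\: (i |: S)|)%N.
  have split_i (F : input n -> nat) : (\sum_(x | C x) F x =
      \sum_(x | C x && (x i == true)) F x +
      \sum_(x | C x && (x i == false)) F x)%N.
    rewrite (bigID (fun x => x i)) /=; congr (_ + _)%N; apply: eq_bigl => x;
      by case: (x i).
  have branch (b : bool) (F : {set 'I_n} -> input n -> nat) :
      (\sum_(x | C x && (x i == b)) F (tested x) x =
       \sum_(x | C x && (x i == b)) F (dt_tested (if b then t1 else t0) x) x)%N.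
    by apply: eq_bigr => x /andP[_ /eqP xi]; rewrite /tested xi.
  rewrite !split_i !doubleD addnACA.
  rewrite !(branch _ (fun T x => Phi ((i |: S) :|: T) x)).
  rewrite !(branch _ (fun T x => #|T :\: (i |: S)|)).
  exact: leq_add (IH1 _ _ (iCb true)) (IH0 _ _ (iCb false)).
have cardE x : (#|(i |: tested x) :\: S| =
    (i \notin S) + #|tested x :\: (i |: S)|)%N.
  rewrite (cardsD1 i) !inE eqxx andbT; congr (_ + #|pred_of_set _|)%N.
  by apply/setP => j; rewrite !inE; case: (j == i); rewrite ?andbF.
under eq_bigr do rewrite finset.setUA [S :|: _]finset.setUC.
under [X in (_ <= _ + X)%N]eq_bigr do rewrite cardE.
rewrite big_split addnA /=; apply: leq_trans IH _.
by rewrite leq_add2r.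
Qed.

Definition term_potential (s : seq 'I_n) S x : nat :=
  if all (fun j => (j \in S) ==> x j) s then (2 ^ count (mem S) s - 1)%N else 0%N.

(** If [i] is in a live term with [j] tested variables, one of the two inputs kills the term and the
    other lifts it to [2^(j+1) - 1 = 2 (2^j - 1) + 1]. Otherwise its potential is unchanged. *)
Lemma term_potential_step (s : seq 'I_n) i S x : uniq s -> i \notin S ->
  (term_potential s (i |: S) x + term_potential s (i |: S) (flip i x) <=
   (term_potential s S x).*2 + (i \in s))%N.
Proof.
move=> us iS; rewrite /term_potential.
have allE (z : input n) : all (fun j => (j \in i |: S) ==> z j) s =
    all (fun j => (j \in S) ==> z j) s && ((i \in s) ==> z i).
  apply/allP/andP => [h|[/allP h /implyP zi] j js].
    split; last by apply/implyP => /h; rewrite finset.setU11.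
    apply/allP => j /h /implyP zj; apply/implyP => jS; apply: zj.
    exact: finset.setU1r.
  apply/implyP; rewrite finset.in_setU1 => /orP[/eqP ji|jS]; first by rewrite ji zi // -ji.
  exact: (implyP (h j js)).
have all_flip : all (fun j => (j \in S) ==> flip i x j) s =
    all (fun j => (j \in S) ==> x j) s.
  apply: eq_all => j; rewrite flipE.
  by case: eqP => [->|]; rewrite ?(negbTE iS) // addbF.
have countE : (count (mem (i |: S)) s = count (mem S) s + (i \in s))%N.
  rewrite -(count_uniq_mem _ us) -count_predUI -[LHS]addn0; congr (_ + _)%N.
    by apply: eq_count => j; rewrite /= finset.in_setU1 orbC.
  rewrite (eq_count (a2 := pred0)) ?count_pred0 // => j /=.
  by case: eqP => [->|]; rewrite ?(negbTE iS) ?andbF.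
rewrite !allE all_flip countE flipE eqxx addbT.
case: all => //=; case: (i \in s) => /=; last by rewrite !addn0 addnn.
rewrite addn1 expnS; have : (0 < 2 ^ count (mem S) s)%N by rewrite expn_gt0.
by case: (x i) => /=; lia.
Qed.

End Potential.

(** * Tree cost and certificate size for a monotone read-once DNF *)

Lemma dt_tested_agree {n} (t : dtree n) (x y : input n) :
  {in dt_tested t x, x =1 y} -> dt_eval t x = dt_eval t y.
Proof.
elim: t => [//|i t0 IH0 t1 IH1] /= agree.
rewrite -agree ?finset.setU11 //.
have sub : {in dt_tested (if x i then t1 else t0) x, x =1 y}.
  by move=> j js; apply: agree; rewrite finset.setU1r.
by case: (x i) sub => sub; [apply: IH1 | apply: IH0].
Qed.

Section MonotoneReadOnce.
Context {n k : nat} {ss : seq (seq 'I_n)}.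
Hypotheses (uss : uniq (flatten ss)) (ksz : {in ss, forall s, size s = k}).

Let f (x : input n) := has (all x) ss.

Lemma uniq_flatten_mem s : s \in ss -> uniq s.
Proof.
move: uss; elim: ss => //= s' ss' IH; rewrite cat_uniq in_cons.
by case/and3P => us' _ uss' /orP[/eqP->|/IH]; last exact.
Qed.

Lemma count_mem_le1 i : (\sum_(s <- ss) (i \in s) <= 1)%N.
Proof.
have : (count_mem i (flatten ss) <= 1)%N by rewrite count_uniq_mem // leq_b1.
rewrite count_flatten sumnE big_map; apply: leq_trans.
rewrite !big_seq; apply: leq_sum => s sss.
by rewrite count_uniq_mem // uniq_flatten_mem.
Qed.

(** Resetting all untested variables to 0 leaves the path of the tree unchanged, so [f] stays true;
    a term true there has only tested variables with value 1. *)
Lemma tested_term (t : dtree n) (x : input n) : dt_computes t f -> f x ->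
  exists2 s, s \in ss & {in s, forall j, (j \in dt_tested t x) && x j}.
Proof.
move=> tf fx.
pose y : input n := [ffun j => (j \in dt_tested t x) && x j].
have : f y.
  rewrite -tf -(@dt_tested_agree _ _ x) ?tf // => j jt.
  by rewrite ffunE jt.
move=> /hasP[s sss /allP ys]; exists s => // j /ys.
by rewrite ffunE.
Qed.

Lemma tree_cost_ge (t : dtree n) : (0 < k)%N -> dt_computes t f ->
  (2 ^ k * \sum_(x | f x) 1 <= \sum_x dt_cost t x)%N.
Proof.
move=> k0 tf.
pose Phi S (x : input n) := (\sum_(s <- ss) term_potential s S x)%N.
have step (i : 'I_n) (S : {set 'I_n}) (x : input n) : i \notin S ->
    (Phi (i |: S) x + Phi (i |: S) (flip i x) <= (Phi S x).*2 + 1)%N.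
  move=> iS; rewrite -big_split -muln2 big_distrl /=.
  apply: leq_trans (leq_add (leqnn _) (count_mem_le1 i)).
  rewrite -big_split !big_seq; apply: leq_sum => s sss.
  by rewrite muln2 term_potential_step // uniq_flatten_mem.
have := potential_cost Phi step t finset.set0 predT (fun _ _ _ => erefl).
have Phi0 x : Phi finset.set0 x = 0%N.
  rewrite /Phi big1 // => s _; rewrite /term_potential.
  rewrite (eq_count (a2 := pred0)) ?count_pred0 ?if_same // => j.
  by rewrite /= inE.
rewrite [X in (_ <= X.*2 + _)%N]big1 => [|x _]; last exact: Phi0.
under eq_bigr do rewrite finset.set0U.
under [X in (_ <= _ + X)%N -> _]eq_bigr do rewrite finset.setD0.
rewrite add0n; apply: leq_trans.
rewrite [X in (_ <= X.*2)%N](bigID f) /= doubleD.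
apply: leq_trans (leq_addr _ _).
rewrite -muln2 !big_distrl big_distrr /=; apply: leq_sum => x fx.
have [s sss st] := tested_term _ _ tf fx.
rewrite /Phi (big_rem s) //= muln1.
have -> : term_potential s (dt_tested t x) x = (2 ^ k - 1)%N.
  rewrite /term_potential -(ksz _ sss).
  have -> : all (fun j => (j \in dt_tested t x) ==> x j) s.
    by apply/allP => j /st /andP[-> ->].
  by congr (2 ^ _ - 1)%N; apply/eqP; rewrite -all_count; apply/allP => j /st /andP[].
(* The potential enters doubled, and [2 (2^k - 1)] reaches [2^k] because [k] is positive. *)
have : (2 <= 2 ^ k)%N by rewrite -{1}(expn1 2) leq_exp2l.
lia.
Qed.

Lemma cert_size_true (x : input n) : f x -> (cert_size f x <= k)%N.
Proof.
move=> /hasP[s sss /allP xs].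
rewrite /cert_size; case: arg_minnP; first exact: total_pa_cert.
move=> b _ /(_ [ffun j => if j \in s then Some true else None]) bmin.
apply: leq_trans (bmin _) _; last first.
  rewrite /pa_size -(ksz _ sss) -(card_uniqP (uniq_flatten_mem _ sss)).
  by apply: subset_leq_card; apply/fintype.subsetP => j; rewrite inE ffunE; case: ifP.
apply/andP; split; last first.
  by apply/forallP => j; rewrite ffunE; case: ifP => //= /xs->.
have true_on a : contains a [ffun j => if j \in s then Some true else None] -> f a.
  move=> /forallP ca; apply/hasP; exists s => //; apply/allP => j js.
  by have := ca j; rewrite ffunE js /= => /eqP[<-].
apply/forallP => a; apply/forallP => a'.
by apply/implyP => /true_on ->; apply/implyP => /true_on ->.
Qed.

End MonotoneReadOnce.

(** * Bounds on the expectations through the probability of falsity *)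

Lemma cert_size_le {n} (f : input n -> bool) (x : input n) :
  (cert_size f x <= n)%N.
Proof. by rewrite -[X in (_ <= X)%N]card_ord; exact: max_card. Qed.

Section Bounds.
Context {R : realType} {n k : nat} {ss : seq (seq 'I_n)}.
Hypotheses (uss : uniq (flatten ss)) (ksz : {in ss, forall s, size s = k}).

Let f (x : input n) := has (all x) ss.

Let p2_gt0 j : (0 : R) < 2 ^+ j. Proof. by rewrite exprn_gt0. Qed.

Definition prob_false : R := (\sum_(x | ~~ f x) 1)%N%:R / 2 ^+ n.

Lemma prob_true : (\sum_(x | f x) 1)%N%:R / 2 ^+ n = 1 - prob_false.
Proof.
apply/eqP; rewrite eq_sym subr_eq -mulrDl -natrD -(bigID f predT) /=.
rewrite sum1_card cardT -cardE card_ffun card_bool card_ord natrX.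
by rewrite divff // lt0r_neq0.
Qed.

Lemma prob_false_le : prob_false <= expR (- ((size ss)%:R / 2 ^+ k)).
Proof.
have -> : prob_false = (1 - (2 ^+ k)^-1) ^+ size ss.
  rewrite /prob_false; have := card_none_true k ss uss ksz.
  move=> /(congr1 (fun m => m%:R : R)); rewrite !natrM !natrX.
  rewrite natrB ?expn_gt0 // natrX exprM => NE.
  have -> : 1 - (2 ^+ k)^-1 = (2 ^+ k - 1) / 2 ^+ k :> R.
    by rewrite mulrBl mul1r divff // lt0r_neq0.
  rewrite expr_div_n; apply/eqP; rewrite eqr_div ?lt0r_neq0 ?exprn_gt0 //.
  by rewrite mulrC NE.
(* Both sides are powers with exponent [size ss], which leaves [1 - y <= expR (- y)] for
   [y = 2^-k]. *)
rewrite -mulrN expRM_natl; apply: lerXn2r; rewrite ?nnegrE ?expR_ge0 //.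
  by rewrite subr_ge0 invf_le1 // exprn_ege1 // ler1n.
exact: expR_ge1Dx.
Qed.

Lemma E_OPT_ge : (0 < k)%N -> 2 ^+ k * (1 - prob_false) <= E_OPT R f.
Proof.
move=> k0; have [t tf ->] := E_OPT_min f R.
rewrite /expect -natr_sum -prob_true mulrA ler_pM2r ?invr_gt0 //.
by rewrite -natrX -natrM ler_nat; exact: tree_cost_ge.
Qed.

Lemma E_CERT_le : E_CERT R f <= k%:R + n%:R * prob_false.
Proof.
rewrite /E_CERT /expect /prob_false mulrA ler_pdivrMr // mulrDl divfK ?lt0r_neq0 //.
rewrite -natr_sum -natrX -!natrM -natrD ler_nat (bigID f) /=.
apply: leq_add.
  rewrite -card_bool -[X in (_ ^ X)%N]card_ord -card_ffun -sum1_card.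
  rewrite big_distrr [X in (_ <= X)%N](bigID f) /=.
  apply: leq_trans (leq_addr _ _); apply: leq_sum => x fx.
  by rewrite muln1; exact: cert_size_true.
rewrite big_distrr; apply: leq_sum => x _ /=.
by rewrite muln1; exact: cert_size_le.
Qed.

End Bounds.

(** * Asymptotics in [n] *)

Lemma ln_sq_le_powR {R : realType} (e : R) : 0 < e ->
  \forall n \near \oo, 2 * ln (n%:R : R) ^+ 2 <= n%:R `^ e.
Proof.
move=> e0; near=> n.
have n1 : (1 : R) <= n%:R by near: n; exact: nbhs_infty_ger.
(* With [L = ln n], the cubic term of the exponential gives [n^e >= (e L)^3 / 3!], which exceeds
   [2 L^2] as soon as [L >= 2 * 3! / e^3]. *)
have Ln : 12 / e ^+ 3 <= ln (n%:R : R).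
  rewrite -[leLHS]expRK ler_ln ?posrE ?expR_gt0 ?(lt_le_trans ltr01) //.
  by near: n; exact: nbhs_infty_ger.
have L0 : 0 <= ln (n%:R : R) by rewrite ln_ge0.
rewrite /powR gt_eqF ?(lt_le_trans ltr01) //.
have := @expR_ge1Dxn R _ 2 (mulr_ge0 (ltW e0) L0).
apply: le_trans; apply: ler_wpDl => //.
rewrite exprMn ler_pdivlMr //.
have := Ln; rewrite ler_pdivrMr ?exprn_gt0 // => Le.
have -> : (3`!%:R : R) = 6 by [].
set L := ln _ in L0 Le *.
have -> : e ^+ 3 * L ^+ 3 = L ^+ 2 * (L * e ^+ 3) by ring.
have -> : 2 * L ^+ 2 * 6 = L ^+ 2 * 12 by ring.
by rewrite ler_wpM2l // exprn_ge0.
Unshelve. all: by end_near. Qed.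

Lemma dnf_evalE {n} (phi : dnf n) : monotone_dnf phi ->
  dnf_eval phi = fun x => has (all x) [seq term_vars t | t <- phi].
Proof.
move=> mono; apply/funext => x; rewrite /dnf_eval has_map.
apply: eq_in_has => t tphi /=; rewrite /term_vars all_map.
by apply: eq_in_all => l lt /=; rewrite (mono t) // eqb_id.
Qed.

(** The concatenated terms list every variable exactly once. *)
Lemma size_dnf {n k} (phi : dnf n) : terms_of_size k phi -> read_once phi ->
  each_var_in_one_term phi -> (k * size phi)%N = n.
Proof.
move=> ksz uphi cover.
have <- : size (flatten [seq term_vars t | t <- phi]) = (k * size phi)%N.
  rewrite size_flatten /shape -map_comp sumnE big_map big_seq.
  rewrite (eq_bigr (fun=> k)) => [|t /ksz //].
  by rewrite -big_seq big_const_seq count_predT iter_addn_0.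
rewrite -[RHS]card_ord -(card_uniqP uphi); apply: eq_card => i.
rewrite inE; apply/flattenP.
have : has (fun t => i \in term_vars t) phi by rewrite has_count cover.
by move=> /hasP[t tphi it]; exists (term_vars t) => //; apply: map_f.
Qed.

(** Falsity has probability at most [1 / n] once [m / 2^k >= ln n]. Since [m k = n] and
    [2^k = n^beta], this reads [k ln n <= n^(1 - beta)], which follows from [k <= 2 ln n] and
    [ln_sq_le_powR]. *)
Lemma admissible_bounds {R : realType} (beta : R) : 0 < beta < 1 ->
  \forall n \near \oo, forall phi : dnf n, admissible beta phi ->
    exists k (ss : seq (seq 'I_n)),
    [/\ dnf_eval phi = (fun x => has (all x) ss), uniq (flatten ss),
        {in ss, forall s, size s = k}, (0 < k)%N &
        [/\ k%:R = beta * log2 (n%:R : R), 2 ^+ k = n%:R `^ beta :> R,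
          (2 <= n)%N & @prob_false R n ss <= n%:R^-1]].
Proof.
move=> /andP[b0 b1]; near=> n => phi.
have n2 : (2 <= n)%N by near: n; exact: nbhs_infty_ge.
have Ln : 2 * ln (n%:R : R) ^+ 2 <= n%:R `^ (1 - beta).
  by near: n; apply: ln_sq_le_powR; rewrite subr_gt0.
case=> k [[kE k0 _] [uphi mono ksz cover]].
have ksz' : {in [seq term_vars t | t <- phi], forall s, size s = k}.
  by move=> _ /mapP[t /ksz tk ->].
have n0 : (0 : R) < n%:R by rewrite ltr0n; apply: leq_trans n2.
have ln2 : (0 : R) < ln 2 by rewrite ln_gt0 // ltr1n.
have pE : 2 ^+ k = n%:R `^ beta :> R.
  rewrite /powR gt_eqF // -[X in X ^+ k](@lnK R) ?posrE // -expRM_natl kE.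
  by rewrite /log2 -mulrA divfK ?lt0r_neq0.
exists k, [seq term_vars t | t <- phi]; split => //; first exact: dnf_evalE.
split => //; apply: le_trans (prob_false_le uphi ksz') _.
rewrite size_map -[leRHS]lnK ?posrE ?invr_gt0 // ler_expR lnV ?posrE // lerN2.
rewrite ler_pdivlMr ?exprn_gt0 //.
have k0' : (0 : R) < k%:R by rewrite ltr0n.
rewrite -(ler_pM2l k0') -natrM (size_dnf _ ksz uphi cover).
have L0 : 0 < ln (n%:R : R) by rewrite ln_gt0 // ltr1n.
(* As [beta < 1], it suffices that [ln 2 >= 1/2], which is [ln (1 + y) <= y] at [y = -1/2]. *)
have kL : k%:R <= 2 * ln (n%:R : R).
  rewrite kE /log2 mulrA ler_pdivrMr // mulrAC ler_pM2r //.
  have := @le_ln1Dx R (- 2^-1).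
  have -> : 1 - 2^-1 = 2^-1 :> R by lra.
  by rewrite lnV ?posrE // ltrN2 invf_lt1 // ltr1n => /(_ isT); lra.
have nE : n%:R = n%:R `^ (1 - beta) * n%:R `^ beta :> R.
  by rewrite -powRD ?subrK ?powRr1 ?(ltW n0) // gt_eqF ?implybT.
rewrite [leRHS]nE pE mulrA ler_wpM2r ?powR_ge0 //; apply: le_trans Ln.
by rewrite expr2 mulrA ler_pM2r.
Unshelve. all: by end_near. Qed.

Theorem theorem6 (R : realType) (beta : R) (hbeta : 0 < beta < 1) :
  (exists2 c : R, 0 < c &
     \forall n \near \oo, forall phi : dnf n, admissible beta phi ->
       c * n%:R `^ beta <= E_OPT R (dnf_eval phi)) /\
  (exists2 C : R, 0 < C &
     \forall n \near \oo, forall phi : dnf n, admissible beta phi ->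
       E_CERT R (dnf_eval phi) <= C * log2 (n%:R : R)).
Proof.
have b0 : 0 < beta by case/andP: hbeta.
have bounds := admissible_bounds beta hbeta.
(* The first constant bounds the probability of truth, at least [1 - 1/n >= 1/2]. In the second, one
   [beta] accounts for [k = beta * log2 n], and the other absorbs the contribution of false inputs,
   at most [1 <= k]. *)
split; [exists 2^-1 | exists (beta + beta)]; rewrite ?invr_gt0 ?addr_gt0 //.
  apply: filterS bounds => n bounds phi.
  move=> /bounds[k [ss [-> uss ksz k0 [_ <- n2 pf]]]].
  apply: le_trans (E_OPT_ge uss ksz k0); rewrite mulrC ler_pM2l ?exprn_gt0 //.
  have : n%:R^-1 <= 2^-1 :> R.
    by rewrite lef_pV2 ?posrE ?ler_nat ?ltr0n // (leq_trans _ n2).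
  lra.
apply: filterS bounds => n bounds phi.
move=> /bounds[k [ss [-> uss ksz k0 [kE _ n2 pf]]]].
apply: le_trans (E_CERT_le uss ksz) _; rewrite mulrDl -kE lerD2l.
have n0 : (0 : R) < n%:R by rewrite ltr0n (leq_trans _ n2).
apply: (@le_trans _ _ 1); last by rewrite ler1n.
by rewrite -ler_pdivlMl // mulr1.
Qed.
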